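(* Let $R$ be a root system in $\mathbb{R}^n$ with positive subsystem $R_+$ and Weyl group $W$, let $k:R\to[0,\infty)$ be $W$-invariant, and let $C=\{x\in\mathbb{R}^n:x\cdot\alpha>0\ \text{for all }\alpha\in R_+\}$. For $x\in C$ define $$\bar\delta(x):=\Big(\prod_{\alpha\in R_+,\,k(\alpha)\ne1/2}(\alpha\cdot x)^{1-2k(\alpha)}\Big)\,\log\Big(\prod_{\alpha\in R_+,\,k(\alpha)=1/2}(\alpha\cdot x)\Big).$$ Then $\bar\delta$ is harmonic in $C$ for the operator $$\mathcal{L}^W_ku(x)=\frac12\Delta u(x)+\sum_{\alpha\in R_+}k(\alpha)\frac{\nabla u(x)\cdot\alpha}{x\cdot\alpha},$$ i.e. $\mathcal{L}^W_k\bar\delta(x)=0$ for every $x\in C$.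
   Context: A root system is a finite set $R\subset\mathbb{R}^n\setminus\{0\}$ with $R\cap\mathbb{R}\alpha=\{\pm\alpha\}$ and $\sigma_\alpha(R)=R$ for all $\alpha\in R$, where $\sigma_\alpha$ is the orthogonal reflection in the hyperplane $H_\alpha=\alpha^\perp$. Roots are normalized by $\alpha\cdot\alpha=2$, so $\sigma_\alpha(x)=x-(\alpha\cdot x)\alpha$. The (finite) Weyl group $W$ is generated by $\{\sigma_\alpha:\alpha\in R\}$. A positive subsystem is $R_+=\{\alpha\in R:\alpha\cdot\beta>0\}$ for some $\beta\notin\bigcup_{\alpha\in R}H_\alpha$. $k:R\to[0,\infty)$ is $W$-invariant if $k(w\alpha)=k(\alpha)$ for all $w\in W$, $\alpha\in R$. Empty products equal $1$. *)

(* Defs.v *)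
From HB Require Import structures.
From mathcomp Require Import all_boot all_order all_algebra.
From mathcomp Require Import finmap.
From mathcomp Require Import all_classical all_reals all_analysis.

Set Implicit Arguments.
Unset Strict Implicit.
Unset Printing Implicit Defensive.

Import Order.TTheory GRing.Theory Num.Theory.
Import numFieldNormedType.Exports.

Local Open Scope fset_scope.
Local Open Scope classical_set_scope.
Local Open Scope ring_scope.

Section RootSystems.
Variables (R : realType) (n : nat).
Implicit Types (Phi Pos : {fset 'rV[R]_n}) (a b x y : 'rV[R]_n).

Definition dot x y : R := \sum_(i < n) x 0 i * y 0 i.

Definition hyperplane a : set 'rV[R]_n := [set x | dot a x = 0].

Definition reflection a x : 'rV[R]_n := x - (2 * dot a x / dot a a) *: a.

Record root_system Phi : Prop := RootSystem {
  root_neq0 : 0 \notin Phi;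
  root_line : forall a, a \in Phi ->
    [set` Phi] `&` range (fun c : R => c *: a) = [set a; - a];
  root_refl : forall a, a \in Phi -> reflection a @` [set` Phi] = [set` Phi]
}.

Definition normalized_roots Phi : Prop := forall a, a \in Phi -> dot a a = 2.

Definition positive_subsystem Phi Pos : Prop :=
  exists2 b, (forall a, a \in Phi -> ~ hyperplane a b) &
             Pos = [fset a in Phi | 0 < dot a b].

(* The subgroup generated by the reflections in the group of bijections of
   R^n; closure under inverses is expressed through two-sided inverse maps. *)
Inductive weyl_group Phi : ('rV[R]_n -> 'rV[R]_n) -> Prop :=
| weyl_id : weyl_group Phi id
| weyl_refl a : a \in Phi -> weyl_group Phi (reflection a)
| weyl_comp v w :
    weyl_group Phi v -> weyl_group Phi w -> weyl_group Phi (v \o w)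
| weyl_inv w w' :
    weyl_group Phi w -> cancel w w' -> cancel w' w -> weyl_group Phi w'.

(* Multiplicities are total functions on R^n; only their values on the roots
   are constrained, and only these are used below. *)
Definition nonneg_multiplicity Phi (k : 'rV[R]_n -> R) : Prop :=
  forall a, a \in Phi -> 0 <= k a.

Definition weyl_invariant Phi (k : 'rV[R]_n -> R) : Prop :=
  forall w a, weyl_group Phi w -> a \in Phi -> k (w a) = k a.

Definition weyl_chamber Pos : set 'rV[R]_n :=
  [set x | forall a, a \in Pos -> 0 < dot x a].

End RootSystems.

Section Operators.
Variables (R : realType) (n : nat).
Implicit Types (Pos : {fset 'rV[R]_n}) (k u : 'rV[R]_n -> R) (x : 'rV[R]_n).

Definition partial (i : 'I_n) u : 'rV[R]_n -> R := 'D_(delta_mx 0 i) u.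

Definition grad u x : 'rV[R]_n := \row_(i < n) partial i u x.

Definition laplacian u x : R := \sum_(i < n) partial i (partial i u) x.

Definition twice_differentiable u x : Prop :=
  (\forall y \near x, differentiable u y) /\
  forall i, differentiable (partial i u) x.

Definition dunkl_laplacian Pos k u x : R :=
  2^-1 * laplacian u x + \sum_(a <- Pos) k a * (dot (grad u x) a / dot x a).

(* The derivatives of the library are total (junk-valued where the limits do
   not exist), so a solution of L u = 0 is required to be twice
   differentiable. *)
Definition harmonic_on (C : set 'rV[R]_n)
    (L : ('rV[R]_n -> R) -> 'rV[R]_n -> R) u : Prop :=
  forall x, C x -> twice_differentiable u x /\ L u x = 0.

Definition delta_bar Pos k x : R :=
  (\prod_(a <- Pos | k a != 2^-1) dot a x `^ (1 - 2 * k a)) *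
  ln (\prod_(a <- Pos | k a == 2^-1) dot a x).

End Operators.

(* Main.v *)
Require Import Defs.
From HB Require Import structures.
From mathcomp Require Import all_boot all_order all_algebra.
From mathcomp Require Import finmap.
From mathcomp Require Import all_classical all_reals all_analysis.
From mathcomp Require Import ring lra.

(* On the chamber, delta_bar = exp h * g, where h and g are the sums over the
   positive roots of (1 - 2 k(a)) ln (a.x) and of 1_{k(a) = 1/2} ln (a.x).
   Their gradients, and the drift, have the form
   V_f = \sum_a f(a) a / (a.x) with f invariant under the reflections. For
   such f and f' the off-diagonal terms of V_f . V_f' cancel, so that
   V_f . V_f' = \sum_a 2 f(a) f'(a) / (a.x)^2. The operator then reduces to a
   sum over single roots, and each coefficient vanishes:
   (1 - 2k)^2 - (1 - 2k) + 2k (1 - 2k) = 0, and 1 - 2k = 0 where k = 1/2. *)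

Set Implicit Arguments.
Unset Strict Implicit.
Unset Printing Implicit Defensive.

Import Order.TTheory GRing.Theory Num.Theory.
Import numFieldNormedType.Exports.

Local Open Scope classical_set_scope.
Local Open Scope ring_scope.

(** An injective self-map of a duplicate-free finite list permutes it, so the two sums agree after
    reindexing. *)
Lemma sum_coboundary_eq0 (T : eqType) (A : zmodType) (s : seq T) (g : T -> T)
    (G : T -> A) :
  uniq s -> {in s &, injective g} -> {in s, forall p, g p \in s} ->
  \sum_(p <- s) (G p - G (g p)) = 0.
Proof.
move=> us ginj gs; rewrite sumrB -(big_map g xpredT G).
have ugs : uniq (map g s) by rewrite map_inj_in_uniq.
have sgs : {subset map g s <= s} by move=> _ /mapP[p ps ->]; exact: gs.
have [_ eqs] : (size (map g s) = size s) * (map g s =i s).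
  by apply: uniq_min_size => //; rewrite size_map.
by rewrite (perm_big (r1 := map g s) s) ?subrr//; exact: uniq_perm.
Qed.

(** * Bilinearity and positivity of the dot product *)

Section Dot.
Variables (R : realType) (n : nat).
Implicit Types (a b x y z : 'rV[R]_n) (c : R).

Lemma dotC x y : dot x y = dot y x.
Proof. by apply: eq_bigr => i _; rewrite mulrC. Qed.

Lemma dotDl x y z : dot (x + y) z = dot x z + dot y z.
Proof. by rewrite -big_split; apply: eq_bigr => i _; rewrite mxE mulrDl. Qed.

Lemma dotZl c x z : dot (c *: x) z = c * dot x z.
Proof. by rewrite mulr_sumr; apply: eq_bigr => i _; rewrite mxE mulrA. Qed.

Lemma dotNl x z : dot (- x) z = - dot x z.
Proof. by rewrite -scaleN1r dotZl mulN1r. Qed.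

Lemma dotDr x y z : dot z (x + y) = dot z x + dot z y.
Proof. by rewrite dotC dotDl !(dotC z). Qed.

Lemma dotZr c x z : dot z (c *: x) = c * dot z x.
Proof. by rewrite dotC dotZl dotC. Qed.

Lemma dotNr x z : dot z (- x) = - dot z x.
Proof. by rewrite dotC dotNl dotC. Qed.

Lemma dot0l x : dot 0 x = 0.
Proof. by rewrite -(scale0r 0) dotZl mul0r. Qed.

Lemma dot_suml (I : Type) (s : seq I) (F : I -> 'rV[R]_n) x :
  dot (\sum_(i <- s) F i) x = \sum_(i <- s) dot (F i) x.
Proof. by elim/big_rec2: _ => [|i u v _ <-]; rewrite ?dot0l ?dotDl. Qed.

Lemma dot_sumr (I : Type) (s : seq I) (F : I -> 'rV[R]_n) x :
  dot x (\sum_(i <- s) F i) = \sum_(i <- s) dot x (F i).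
Proof. by rewrite dotC dot_suml; apply: eq_bigr => i _; rewrite dotC. Qed.

Lemma dot_gt0 x : x != 0 -> 0 < dot x x.
Proof.
move=> x0; rewrite lt_neqAle sumr_ge0 ?andbT; last first.
  by move=> i _; rewrite -expr2 sqr_ge0.
apply: contraNN x0; rewrite eq_sym psumr_eq0; last first.
  by move=> i _; rewrite -expr2 sqr_ge0.
move=> /allP x0; apply/eqP/rowP => i; rewrite mxE.
by have := x0 i (mem_index_enum i); rewrite -expr2 sqrf_eq0 => /eqP.
Qed.

Lemma dot_delta x (i : 'I_n) : dot x (delta_mx 0 i) = x 0 i.
Proof.
rewrite /dot (bigD1 i)//= mxE !eqxx mulr1 big1 ?addr0// => j ji.
by rewrite mxE (negbTE ji) andbF mulr0.
Qed.

End Dot.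

(** * Cancellation in sums over pairs of roots *)

Section RootSums.
Variables (R : realType) (n : nat) (Phi : {fset 'rV[R]_n}).
Hypotheses (hPhi : root_system Phi) (hnorm : normalized_roots Phi).
Implicit Types (a b x : 'rV[R]_n) (f g : 'rV[R]_n -> R).

Definition refl_invariant f : Prop :=
  {in Phi &, forall b a, f (reflection b a) = f a}.

(** The gradient of [\sum_(a <- s) f a * ln (dot a x)]; with the multiplicity as [f] it is the drift
    field of the operator. *)
Definition log_grad (s : seq 'rV[R]_n) f x : 'rV[R]_n :=
  \sum_(a <- s) (f a / dot a x) *: a.

Lemma reflE b a : b \in Phi -> reflection b a = a - dot b a *: b.
Proof.
by move=> bP; rewrite /reflection hnorm// mulrAC divff ?mul1r ?pnatr_eq0.
Qed.

Lemma reflection_root b a : b \in Phi -> a \in Phi -> reflection b a \in Phi.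
Proof.
move=> bP aP; have : (reflection b @` [set` Phi]) (reflection b a) by exists a.
by rewrite root_refl.
Qed.

Lemma reflection_self a : a \in Phi -> reflection a a = - a.
Proof.
by move=> aP; rewrite reflE// hnorm// scaler_nat mulr2n opprD addrA subrr sub0r.
Qed.

Lemma reflectionK a b : b \in Phi -> reflection b (reflection b a) = a.
Proof.
move=> bP; rewrite !reflE// dotDr dotNr dotZr hnorm//.
by apply/rowP => i; rewrite !mxE; ring.
Qed.

Lemma oppr_root a : a \in Phi -> - a \in Phi.
Proof. by move=> aP; rewrite -reflection_self//; exact: reflection_root. Qed.

Lemma refl_invariantN f : refl_invariant f -> {in Phi, forall a, f (- a) = f a}.
Proof. by move=> fi a aP; rewrite -reflection_self// fi. Qed.

Lemma root_neqN a : a \in Phi -> (a == - a) = false.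
Proof.
move=> aP; apply/eqP => aN; have := hnorm aP.
by rewrite {1}aN dotNl hnorm// => /eqP; rewrite lt_eqF// -subr_gt0; lra.
Qed.

(* Two roots at angle [phi] go to the next pair at angle [phi] in their plane.
   The summand [cos phi / (cos t * cos (t + phi))] is, up to the factor
   [cot phi], the increment [tan (t + phi) - tan t]; the vertical component of
   the tangent is replaced here by the ratio [dot b x / dot a x], and [sin phi]
   by the step-invariant quadratic form [Q]. *)
Lemma root_pair_sum_eq0 f g x :
  refl_invariant f -> refl_invariant g ->
  {in Phi, forall a, dot a x != 0} ->
  \sum_(p <- [seq (a, b) | a <- Phi, b <- Phi] |
        (p.1 != p.2) && (p.1 != - p.2))
     (f p.1 * g p.2 + f p.2 * g p.1) *
     (dot p.1 p.2 / (dot p.1 x * dot p.2 x)) = 0.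
Proof.
move=> fi gi x0; rewrite -big_filter; set s := [seq p <- _ | _].
have us : uniq s.
  by rewrite filter_uniq//; apply: allpairs_uniq; [exact: fset_uniq..|]; move=> [? ?] [? ?].
have memsP a b :
    ((a, b) \in s) = [&& a \in Phi, b \in Phi, a != b & a != - b].
  rewrite mem_filter/= andbC [RHS]andbA; congr andb.
  apply/allpairsP/andP => [[[c d] [/= ? ? [-> ->]]]//|[? ?]].
  by exists (a, b).
(* In the plane of a and b, minus the reflection in b is the mirror map across the line of b, so T
   rotates the pair by its own angle. With x projected to length r on that plane, Q = 2 r^2 sin^2
   phi. *)
pose T (p : 'rV[R]_n * 'rV[R]_n) := (p.2, - reflection p.2 p.1).
pose Q (p : 'rV[R]_n * 'rV[R]_n) :=
  dot p.1 x ^+ 2 + dot p.2 x ^+ 2 - dot p.1 p.2 * dot p.1 x * dot p.2 x.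
(* For u = a.x, v = b.x, c = a.b one has v/u - (cv - u)/v = Q/(uv), so [G p - G (T p)] is the
   summand. The symmetrized weight is needed: T turns f(a) g(b) into f(b) g(a). *)
pose G p := (f p.1 * g p.2 + f p.2 * g p.1) * dot p.1 p.2
            * (dot p.2 x / dot p.1 x) / Q p.
have Ts : {in s, forall p, T p \in s}.
  move=> [a b]; rewrite !memsP => /and4P[aP bP ab abN] /=.
  rewrite bP oppr_root ?reflection_root//= opprK.
  (* If the reflection of a in b were -b or b, reflecting once more would give a = b or a = -b. *)
  apply/andP; split; apply/eqP => e; move: (reflectionK a bP).
    have -> : reflection b a = - b by rewrite {2}e opprK.
    rewrite -reflection_self// reflectionK// => ba.
    by rewrite ba eqxx in ab.
  by rewrite -e reflection_self// => ba; rewrite -ba eqxx in abN.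
have Tinj : {in s &, injective T}.
  move=> [a b] [a' b']; rewrite !memsP => /and4P[aP bP _ _] /and4P[aP' bP' _ _].
  case=> <-; rewrite !reflE// => /oppr_inj e; congr pair.
  have : dot b (a - dot b a *: b) = dot b (a' - dot b a' *: b) by rewrite e.
  rewrite !dotDr !dotNr !dotZr hnorm// => ba.
  by move: e; rewrite (_ : dot b a = dot b a') => [/addIr|]; last lra.
rewrite -[RHS](sum_coboundary_eq0 G us Tinj Ts).
rewrite big_seq [RHS]big_seq; apply: eq_bigr => -[a b].
rewrite memsP /= => /and4P[aP bP ab abN].
have ax := x0 _ aP; have bx := x0 _ bP.
have da := hnorm aP; have db := hnorm bP.
(* Positivity of |a - b|^2 and |a + b|^2 gives |a.b| < 2, so Q is positive definite in (a.x,
   b.x). *)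
have Qn0 : Q (a, b) != 0.
  rewrite /Q/=.
  have := @dot_gt0 _ _ (a - b); rewrite subr_eq0 => /(_ ab).
  have := @dot_gt0 _ _ (a + b); rewrite addr_eq0 => /(_ abN).
  rewrite !(dotDl, dotDr, dotNl, dotNr) da db (dotC b a).
  move: (dot a b) (dot a x) (dot b x) ax bx => c u v u0 v0 c1 c2.
  rewrite gt_eqF//.
  have -> : u ^+ 2 + v ^+ 2 - c * u * v =
    (u - c * v / 2) ^+ 2 + v ^+ 2 * ((2 - c) * (2 + c) / 4) by field.
  rewrite ltr_wpDl ?sqr_ge0//.
  apply: mulr_gt0; first by rewrite exprn_even_gt0.
  by apply: divr_gt0 => //; apply: mulr_gt0; lra.
have fT : f (- reflection b a) = f a.
  by rewrite refl_invariantN ?reflection_root// fi.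
have gT : g (- reflection b a) = g a.
  by rewrite refl_invariantN ?reflection_root// gi.
have eqQ : Q (T (a, b)) = Q (a, b).
  rewrite /Q/T/= reflE// !(dotDl, dotDr, dotNl, dotNr, dotZl, dotZr) db.
  by rewrite (dotC b a); ring.
rewrite /G eqQ /T/= fT gT reflE//.
rewrite !(dotDl, dotDr, dotNl, dotNr, dotZl, dotZr) db (dotC b a).
move: Qn0; rewrite /Q/=.
move: (dot a b) (dot a x) (dot b x) ax bx => c u v u0 v0 Qn0.
by field; rewrite u0 v0 Qn0.
Qed.

(** In the double sum over roots only b = a and b = -a survive. Both contribute 2 f(a) g(a) /
    (a.x)^2, since the signs in a.b and b.x cancel. *)
Lemma dot_log_grad_root f g x :
  refl_invariant f -> refl_invariant g ->
  {in Phi, forall a, dot a x != 0} ->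
  dot (log_grad Phi f x) (log_grad Phi g x) =
  \sum_(a <- Phi) 4 * (f a * g a / dot a x ^+ 2).
Proof.
move=> fi gi x0.
pose t a b := dot a b / (dot a x * dot b x).
have tC a b : t a b = t b a by rewrite /t dotC (mulrC (dot a x)).
have -> : dot (log_grad Phi f x) (log_grad Phi g x) =
    \sum_(a <- Phi) \sum_(b <- Phi) f a * g b * t a b.
  rewrite /log_grad dot_suml; apply: eq_bigr => a _.
  rewrite dot_sumr; apply: eq_bigr => b _.
  by rewrite dotZl dotZr /t invfM; ring.
(* Doubling symmetrizes the weights, as the cancellation of pairs requires. *)
have dbl : (\sum_(a <- Phi) \sum_(b <- Phi) f a * g b * t a b) * 2 =
    \sum_(a <- Phi) \sum_(b <- Phi) (f a * g b + f b * g a) * t a b.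
  rewrite mulr_natr mulr2n {2}exchange_big/= -big_split/=.
  apply: eq_bigr => a _; rewrite -big_split/=; apply: eq_bigr => b _.
  by rewrite (tC b a); ring.
have two0 : (2 : R) != 0 by rewrite pnatr_eq0.
apply: (mulIf two0).
rewrite dbl mulr_suml.
have := root_pair_sum_eq0 fi gi x0.
rewrite big_mkcond big_allpairs_dep/= => off.
rewrite -[LHS]subr0 -[X in _ - X]off -sumrB !big_seq; apply: eq_bigr => a aP.
rewrite -sumrB.
pose F b := (f a * g b + f b * g a) * t a b.
transitivity (\sum_(b <- Phi) ((if b == a then F b else 0) +
                               (if b == - a then F b else 0))).
  apply: eq_bigr => b _; rewrite -/(F b) -[b == - a]eqr_oppLR.
  rewrite [b == a]eq_sym [- b == a]eq_sym.
  have [<-|_] /= := eqVneq a b.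
    by rewrite root_neqN ?subr0 ?addr0.
  by case: eqVneq => _; rewrite /= ?subr0 ?subrr ?addr0 ?add0r.
have pick c : c \in Phi -> \sum_(b <- Phi) (if b == c then F b else 0) = F c.
  move=> cP; rewrite (bigD1_seq c) ?fset_uniq//= eqxx big1 ?addr0//.
  by move=> b /negbTE ->.
rewrite big_split/= !pick ?oppr_root// /F /t.
rewrite dotNr dotNl !refl_invariantN// hnorm//.
by have := x0 a aP; move: (dot a x) => u u0; field.
Qed.

(** The roots are the disjoint union of [Pos] and its negatives, and f(a) a / (a.x) is even in a.
    Passing to [Pos] thus halves each field and the sum on the right, which turns the constant 4
    into 2. *)
Lemma dot_log_grad (Pos : {fset 'rV[R]_n}) f g x :
  positive_subsystem Phi Pos ->
  refl_invariant f -> refl_invariant g ->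
  {in Pos, forall a, 0 < dot a x} ->
  dot (log_grad Pos f x) (log_grad Pos g x) =
  \sum_(a <- Pos) 2 * (f a * g a / dot a x ^+ 2).
Proof.
move=> [b bn0 PosE] fi gi xPos.
have PosP a : (a \in Pos) = (a \in Phi) && (0 < dot a b).
  by rewrite PosE !inE.
have permPhi : perm_eq Phi (Pos ++ map -%R Pos).
  apply: uniq_perm; first exact: fset_uniq.
    rewrite cat_uniq fset_uniq map_inj_uniq ?fset_uniq ?andbT; last exact: oppr_inj.
    apply/hasPn => _ /mapP[a aP ->]; move: aP; rewrite !PosP => /andP[_ ab].
    by rewrite dotNl oppr_gt0 [dot a b < 0]ltNge (ltW ab) andbF.
  move=> a; rewrite mem_cat; apply/idP/orP.
    move=> aP; have [ab|ab|ab] := ltrgtP (dot a b) 0.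
    - right; apply/mapP; exists (- a); last by rewrite opprK.
      by rewrite PosP oppr_root// dotNl oppr_gt0.
    - by left; rewrite PosP aP.
    - by have := bn0 a aP.
  move=> [|/mapP[c]]; rewrite PosP => /andP[cP _] //.
  by move=> ->; exact: oppr_root.
have sumPhi (A : zmodType) (h : 'rV[R]_n -> A) :
    \sum_(a <- Phi) h a = \sum_(a <- Pos) (h a + h (- a)).
  by rewrite (perm_big _ permPhi) big_cat big_map big_split.
have lgPhi h : refl_invariant h ->
    log_grad Phi h x = 2 *: log_grad Pos h x.
  move=> hi; rewrite /log_grad sumPhi scaler_sumr big_seq [RHS]big_seq.
  apply: eq_bigr => a; rewrite PosP => /andP[aP _].
  by rewrite refl_invariantN// dotNl invrN mulrN scaleNr scalerN opprK scaler_nat.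
have x0 : {in Phi, forall a, dot a x != 0}.
  move=> a; rewrite (perm_mem permPhi) mem_cat => /orP[/xPos/gt_eqF->//|].
  by move=> /mapP[c /xPos cx ->]; rewrite dotNl oppr_eq0 gt_eqF.
have := dot_log_grad_root fi gi x0.
rewrite !lgPhi// dotZl dotZr sumPhi => e.
have two0 : (4 : R) != 0 by rewrite pnatr_eq0.
apply: (mulfI two0); rewrite [LHS](_ : _ = 2 * (2 * dot (log_grad Pos f x)
  (log_grad Pos g x))); last by ring.
rewrite e mulr_sumr big_seq [RHS]big_seq.
apply: eq_bigr => a; rewrite PosP => /andP[aP _].
by rewrite !refl_invariantN// dotNl sqrrN; ring.
Qed.

End RootSums.

(** The first-order expansion of f at x is also one of g, and differentials are unique. This
    localization is needed because the closed formulas for [delta_bar] and its partial derivatives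
    are established only where all a.x are positive. *)
Lemma near_eq_is_diff (R : numFieldType) (V W : normedModType R)
    (f g df : V -> W) (x : V) :
  (\forall y \near x, f y = g y) -> is_diff x f df -> is_diff x g df.
Proof.
move=> fg [fx <-].
have fgx : f x = g x by exact: (nbhs_singleton fg).
have gd : g \o shift x = cst (g x) + 'd f x +o_ 0 id.
  apply/eqaddoP => _/posnumP[e].
  have /eqaddoP /(_ _ (gt0 e)) fd := diff_locally fx.
  have fg0 : \forall h \near 0, f (h + x) = g (h + x).
    by move: fg; rewrite [X in X -> _](near_shift 0) subr0.
  near=> h.
  have -> : (g \o shift x - (cst (g x) + 'd f x)) h =
            (f \o shift x - (cst (f x) + 'd f x)) h.
    by rewrite !fctE /= fgx; congr (_ - _); rewrite (near fg0 h).
  by near: h.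
have dgf : 'd g x = 'd f x :> (V -> W).
  exact: diff_unique (diff_continuous fx) gd.
apply: DiffDef => //; apply/diff_locallyP; rewrite dgf; split => //.
exact: diff_continuous.
Unshelve. all: by end_near. Qed.

(** * Calculus of gradients *)

Section Gradient.
Variables (R : realType) (n : nat).
Implicit Types (u v : 'rV[R]_n -> R) (a x G H : 'rV[R]_n).

(** Full differentiability is included, so one fact yields both the regularity demanded by
    [twice_differentiable] and the values of the partial derivatives. *)
Definition has_gradient u x G : Prop := is_diff x u (dot G).

Lemma near_eq_has_gradient u v x G :
  (\forall y \near x, u y = v y) -> has_gradient u x G -> has_gradient v x G.
Proof. exact: near_eq_is_diff. Qed.

Lemma has_gradient_cst (c : R) x : has_gradient (fun=> c) x 0.
Proof.
by apply: is_diff_eq; apply/funext => y; rewrite /= dot0l.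
Qed.

Lemma has_gradientD u v x G H : has_gradient u x G -> has_gradient v x H ->
  has_gradient (fun y => u y + v y) x (G + H).
Proof.
move=> uG vH; apply: (is_diff_eq (is_diffD uG vH)).
by apply/funext => y; rewrite fctE dotDl.
Qed.

Lemma has_gradientM u v x G H : has_gradient u x G -> has_gradient v x H ->
  has_gradient (fun y => u y * v y) x (u x *: H + v x *: G).
Proof.
move=> uG vH; apply: (is_diff_eq (is_diffM uG vH)).
by apply/funext => y; rewrite !fctE dotDl !dotZl.
Qed.

Lemma has_gradientZ (c : R) u x G : has_gradient u x G ->
  has_gradient (fun y => c * u y) x (c *: G).
Proof.
move=> /(has_gradientM (has_gradient_cst c x)).
by rewrite scaler0 addr0.
Qed.

Lemma has_gradient_sum (I : eqType) (s : seq I) (u : I -> 'rV[R]_n -> R) x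
    (G : I -> 'rV[R]_n) :
  {in s, forall i, has_gradient (u i) x (G i)} ->
  has_gradient (fun y => \sum_(i <- s) u i y) x (\sum_(i <- s) G i).
Proof.
elim: s => [_|i s IHs us].
  rewrite big_nil (_ : (fun _ => _) = fun=> 0); first exact: has_gradient_cst.
  by apply/funext => y; rewrite big_nil.
rewrite big_cons (_ : (fun _ => _) = fun y => u i y + \sum_(j <- s) u j y).
  apply: has_gradientD; first by apply: us; rewrite mem_head.
  by apply: IHs => j js; apply: us; rewrite inE js orbT.
by apply/funext => y; rewrite big_cons.
Qed.

Lemma has_gradient_comp (phi : R -> R) (d : R) u x G :
  is_derive (u x) 1 phi d -> has_gradient u x G ->
  has_gradient (fun y => phi (u y)) x (d *: G).
Proof.
move=> [/derivable1_diffP phid phiE] uG.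
have phiD : is_diff (u x) phi (fun h => h *: d).
  by apply: DiffDef => //; rewrite diff1E// derive1E phiE.
apply: (is_diff_eq (is_diff_comp uG phiD)).
by apply/funext => y; rewrite /= dotZl mulrC.
Qed.

Lemma has_gradient_dot a x : has_gradient (dot a) x a.
Proof.
have dota_lin : linear (dot a).
  by move=> c y z; rewrite dotDr dotZr.
pose dotaM := GRing.isLinear.Build _ _ _ _ _ dota_lin.
pose dota : {linear _ -> _} := HB.pack (dot a) dotaM.
(* A continuous linear map is its own differential; continuity comes from the coordinates. *)
have dota_cont : continuous dota.
  move=> y; apply: differentiable_continuous.
  rewrite (_ : (dota : _ -> _) = \sum_(i < n) (fun z : 'rV[R]_n => a 0 i * z 0 i)).
    apply: differentiable_sum => i; apply: differentiableM => //.
    exact: differentiable_coord.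
  by apply/funext => z; rewrite fct_sumE.
rewrite /has_gradient -[dot a]/(dota : _ -> _); apply: DiffDef.
  exact: linear_differentiable.
by rewrite diff_lin.
Qed.

Lemma has_gradient_partial u x G i : has_gradient u x G -> partial i u x = G 0 i.
Proof.
by move=> [ud uG]; rewrite /partial deriveE// uG dot_delta.
Qed.

Lemma has_gradient_grad u x G : has_gradient u x G -> grad u x = G.
Proof.
by move=> uG; apply/rowP => i; rewrite mxE (has_gradient_partial i uG).
Qed.

End Gradient.

(** * Sums of logarithms of linear forms and their derivatives *)

Section LogSums.
Variables (R : realType) (n : nat) (s : seq 'rV[R]_n).
Implicit Types (a x y : 'rV[R]_n) (f : 'rV[R]_n -> R).

Definition log_sum f x : R := \sum_(a <- s) f a * ln (dot a x).

(** A finite intersection of open half-spaces is open. *)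
Lemma near_dot_gt0 x : {in s, forall a, 0 < dot a x} ->
  \forall y \near x, {in s, forall a, 0 < dot a y}.
Proof.
elim: s => [_|a r IHr pos]; first by near=> y => b.
have dota_cont : {for x, continuous (dot a)}.
  by apply: differentiable_continuous; case: (has_gradient_dot a x).
have nr : \forall y \near x, {in r, forall b, 0 < dot b y}.
  by apply: IHr => b br; apply: pos; rewrite inE br orbT.
have na : \forall y \near x, 0 < dot a y.
  by apply: (cvgr_gt (dot a x) dota_cont); apply: pos; rewrite mem_head.
near=> y => b; rewrite inE => /orP[/eqP ->|].
  by near: y.
by move: b; near: y.
Unshelve. all: by end_near. Qed.

Lemma has_gradient_log_sum f x : {in s, forall a, 0 < dot a x} ->
  has_gradient (log_sum f) x (log_grad s f x).
Proof.
move=> pos; apply: has_gradient_sum => a /pos ax.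
rewrite -scalerA; apply: has_gradientZ; apply: has_gradient_comp.
  exact: is_derive1_ln.
exact: has_gradient_dot.
Qed.

(** Row i of the Hessian of [log_sum f]. *)
Definition log_hess (f : 'rV[R]_n -> R) (i : 'I_n) x : 'rV[R]_n :=
  \sum_(a <- s) (- (f a * a 0 i / dot a x ^+ 2)) *: a.

Lemma has_gradient_log_grad f i x : {in s, forall a, 0 < dot a x} ->
  has_gradient (fun y => log_grad s f y 0 i) x (log_hess f i x).
Proof.
move=> pos; rewrite (_ : (fun _ => _) =
    fun y => \sum_(a <- s) (f a * a 0 i) * (dot a y)^-1); last first.
  apply/funext => y; rewrite /log_grad summxE; apply: eq_bigr => a _.
  by rewrite mxE mulrAC.
apply: has_gradient_sum => a /pos ax.
rewrite -mulrN -scalerA; apply: has_gradientZ.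
apply: (has_gradient_comp (phi := fun t => t^-1)); last exact: has_gradient_dot.
have := @is_deriveV R id (dot a x) 1 1 (lt0r_neq0 ax) (is_derive_id _ _).
by rewrite /GRing.scale/= mulr1.
Qed.

Lemma tr_log_hess f x :
  \sum_(i < n) log_hess f i x 0 i =
  - \sum_(a <- s) f a * dot a a / dot a x ^+ 2.
Proof.
under eq_bigr do rewrite summxE.
rewrite exchange_big/= -sumrN; apply: eq_bigr => a _.
rewrite mulr_sumr mulr_suml -sumrN; apply: eq_bigr => i _.
by rewrite mxE; ring.
Qed.

End LogSums.

(** * The function [delta_bar] and its image under the operator *)

Lemma delta_barE (R : realType) (n : nat) (Pos : {fset 'rV[R]_n})
    (k : 'rV[R]_n -> R) (x : 'rV[R]_n) :
  {in Pos, forall a, 0 < dot a x} ->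
  delta_bar Pos k x = expR (log_sum Pos (fun a => 1 - 2 * k a) x) *
                      log_sum Pos (fun a => (k a == 2^-1)%:R) x.
Proof.
move=> pos; rewrite /delta_bar /log_sum; congr (_ * _).
  (* Roots with k(a) = 1/2 may join the product: their exponent 1 - 2k(a) is 0, so they contribute
     exp 0 = 1. *)
  rewrite big_mkcond/= expR_sum big_seq [RHS]big_seq; apply: eq_bigr => a aP.
  have [->|_] := eqVneq (k a) (2^-1); last by rewrite /powR gt_eqF// pos.
  by rewrite divff ?pnatr_eq0// subrr mul0r expR0.
have : {in (Pos : seq _), forall a, 0 < dot a x} by [].
elim: (Pos : seq _) => [_|a r IHr rpos]; first by rewrite !big_nil ln1.
have ax : 0 < dot a x by apply: rpos; rewrite mem_head.
have {}rpos : {in r, forall a, 0 < dot a x}.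
  by move=> b br; apply: rpos; rewrite inE br orbT.
rewrite !big_cons; case: eqP => _; last by rewrite mul0r add0r IHr.
rewrite lnM ?posrE//; last first.
  by rewrite big_seq_cond prodr_gt0// => b /andP[/rpos].
by rewrite mul1r IHr.
Qed.

Lemma refl_invariant_comp (R : realType) (n : nat) (Phi : {fset 'rV[R]_n})
    (k : 'rV[R]_n -> R) (phi : R -> R) :
  weyl_invariant Phi k -> refl_invariant Phi (fun a => phi (k a)).
Proof. by move=> kW b a bP aP; rewrite kW//; exact: weyl_refl. Qed.

Theorem lemma10 (R : realType) (n : nat) (Phi Pos : {fset 'rV[R]_n})
    (k : 'rV[R]_n -> R)
    (hPhi : root_system Phi) (hnorm : normalized_roots Phi)
    (hPos : positive_subsystem Phi Pos)
    (hk0 : nonneg_multiplicity Phi k) (hkW : weyl_invariant Phi k) :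
  harmonic_on (weyl_chamber Pos) (dunkl_laplacian Pos k) (delta_bar Pos k).
Proof.
move=> x Cx.
have xpos : {in Pos, forall a, 0 < dot a x} by move=> a /Cx; rewrite dotC.
have PosPhi : {subset Pos <= Phi}.
  by case: hPos => b _ -> a; rewrite !inE => /andP[].
pose p a := 1 - 2 * k a.
pose q a : R := (k a == 2^-1)%:R.
have pi : refl_invariant Phi p.
  exact: (refl_invariant_comp (fun t => 1 - 2 * t)).
have qi : refl_invariant Phi q.
  exact: (refl_invariant_comp (fun t => (t == 2^-1)%:R)).
have ki : refl_invariant Phi k by exact: (refl_invariant_comp id).
pose E y := expR (log_sum Pos p y); pose g := log_sum Pos q.
(* The product rule for E g, with grad E = E grad(ln E). *)
pose D y := E y *: (g y *: log_grad Pos p y + log_grad Pos q y).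
have Egrad y : {in Pos, forall a, 0 < dot a y} ->
    has_gradient E y (E y *: log_grad Pos p y).
  move=> ypos; apply: (has_gradient_comp (phi := expR)).
  exact: has_gradient_log_sum.
have ugrad y : {in Pos, forall a, 0 < dot a y} ->
    has_gradient (delta_bar Pos k) y (D y).
  move=> ypos; apply: (@near_eq_has_gradient _ _ (fun z => E z * g z)).
    by apply: filterS (near_dot_gt0 ypos) => z zpos; rewrite delta_barE.
  rewrite /D scalerDr addrC scalerA mulrC -scalerA.
  by apply: has_gradientM; [exact: Egrad|exact: has_gradient_log_sum].
pose P i := log_hess Pos p i x; pose Q i := log_hess Pos q i x.
pose H := log_grad Pos p x; pose M := log_grad Pos q x.
(* The product rule applied to coordinate i of [D]; P i and Q i are the Hessian rows of ln E and of
   g. *)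
have pgrad i : has_gradient (partial i (delta_bar Pos k)) x
    (E x *: (g x *: P i + H 0 i *: M + Q i)
     + (g x * H 0 i + M 0 i) *: (E x *: H)).
  apply: (@near_eq_has_gradient _ _ (fun y => E y *
      (g y * log_grad Pos p y 0 i + log_grad Pos q y 0 i))).
    apply: filterS (near_dot_gt0 xpos) => z zpos.
    by rewrite (has_gradient_partial i (ugrad z zpos)) !mxE.
  apply: has_gradientM; first exact: Egrad.
  apply: has_gradientD; last exact: has_gradient_log_grad.
  apply: has_gradientM; first exact: has_gradient_log_sum.
  exact: has_gradient_log_grad.
split.
  split; last by move=> i; case: (pgrad i).
  by apply: filterS (near_dot_gt0 xpos) => z /ugrad[].
(* Every remaining trace and dot product is a multiple of some [S f]; [trS] uses the normalization
   a.a = 2. *)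
pose S f := \sum_(a <- Pos) f a / dot a x ^+ 2.
have dotS f h : refl_invariant Phi f -> refl_invariant Phi h ->
    dot (log_grad Pos f x) (log_grad Pos h x) = 2 * S (fun a => f a * h a).
  move=> fi hi; rewrite (dot_log_grad hPhi hnorm hPos)// mulr_sumr.
  by apply: eq_bigr => a _.
have trS f : \sum_(i < n) log_hess Pos f i x 0 i = - (2 * S f).
  rewrite tr_log_hess mulr_sumr; congr (- _).
  rewrite big_seq [RHS]big_seq; apply: eq_bigr => a /PosPhi aP.
  by rewrite hnorm//; ring.
have lapE : laplacian (delta_bar Pos k) x =
    2 * E x * (g x * S (fun a => p a * p a) + 2 * S (fun a => p a * q a)
               - g x * S p - S q).
  (* The cross term H.M occurs twice: once from differentiating g, once from differentiating E. *)
  transitivity (E x * (g x * (\sum_(i < n) P i 0 i) + \sum_(i < n) Q i 0 i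
      + 2 * dot H M + g x * dot H H)).
    rewrite /dot !mulr_sumr -!big_split mulr_sumr /=; apply: eq_bigr => i _.
    by rewrite (has_gradient_partial i (pgrad i)) !mxE; ring.
  by rewrite !trS !dotS//; ring.
have driftE : \sum_(a <- Pos) k a * (dot (grad (delta_bar Pos k) x) a / dot x a)
    = 2 * E x * (g x * S (fun a => p a * k a) + S (fun a => q a * k a)).
  transitivity (dot (D x) (log_grad Pos k x)).
    rewrite (has_gradient_grad (ugrad x xpos)) dot_sumr.
    by apply: eq_bigr => a _; rewrite dotZr (dotC x); ring.
  by rewrite dotZl dotDl dotZl !dotS//; ring.
(* Termwise, p (p - 1 + 2k) = 0 by the choice of p. *)
have Sp : S (fun a => p a * p a) - S p + 2 * S (fun a => p a * k a) = 0.
  rewrite mulr_sumr -sumrB -big_split big1// => a _.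
  by rewrite /= /p; ring.
(* Termwise, q (2p - 1 + 2k) = q p, and p vanishes on the support of q. *)
have Sq : 2 * S (fun a => p a * q a) - S q + 2 * S (fun a => q a * k a) = 0.
  rewrite !mulr_sumr -sumrB -big_split big1// => a _.
  rewrite /= /p /q; move: (dot a x ^+ 2)^-1 => c.
  by case: eqP => [->|_] /=; [field|ring].
rewrite /dunkl_laplacian lapE driftE.
(* The terms containing the factor g and those without it vanish separately. *)
transitivity (E x * (g x * (S (fun a => p a * p a) - S p + 2 * S (fun a => p a * k a))
  + (2 * S (fun a => p a * q a) - S q + 2 * S (fun a => q a * k a)))).
  by field.
by rewrite Sp Sq mulr0 addr0 mulr0.
Qed.
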